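(* Any $\Sigma$-formula $\phi$ is equivalent in $\mathfrak{B}$ to an $\mathcal{L}_{BT}$-formula $\phi'$ of one of the forms $$\phi' \equiv (\mathbf{Q}_{1}^{t_{1}} v_{1})\ldots(\mathbf{Q}_{m}^{t_{m}} v_{m})\,(s=t)\quad\text{or}\quad \phi' \equiv (\exists v)(\mathbf{Q}_{1}^{t_{1}} v_{1})\ldots(\mathbf{Q}_{m}^{t_{m}} v_{m})\,(s=t)$$ where $t_1,\ldots,t_m,s,t$ are $\mathcal{L}_{BT}$-terms and $\mathbf{Q}_{j}^{t_{j}} v_{j}\in\{\exists v_j\sqsubseteq t_j,\ \forall v_j\sqsubseteq t_j\}$ for $j=1,\ldots,m$.
   Context: $\mathcal{L}_{BT}$ is the first-order language (with equality) consisting of the constant symbols $e,0,1$, the binary function symbol $\circ$ and the binary relation symbol $\sqsubseteq$. The $\mathcal{L}_{BT}$-structure $\mathfrak{B}$: its universe is the set $\{\boldsymbol{0},\boldsymbol{1}\}^*$ of all finite bit strings, including the empty string $\varepsilon$; $e^{\mathfrak{B}}=\varepsilon$, $0^{\mathfrak{B}}$ is the one-bit string $\boldsymbol{0}$, $1^{\mathfrak{B}}$ is the one-bit string $\boldsymbol{1}$; $\circ^{\mathfrak{B}}$ is concatenation; and $u \sqsubseteq^{\mathfrak{B}} v$ iff $u$ is a substring of $v$, i.e. iff there exist bit strings $x,y$ with $xuy=v$. Bounded quantifiers: $(\exists x\sqsubseteq t)\alpha$ abbreviates $(\exists x)[x\sqsubseteq t\wedge\alpha]$ and $(\forall x\sqsubseteq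 t)\alpha$ abbreviates $(\forall x)[x\sqsubseteq t\rightarrow\alpha]$, where $x$ does not occur in the term $t$. The $\Sigma$-formulas are defined inductively: $\alpha$ and $\neg\alpha$ are $\Sigma$-formulas if $\alpha$ is of the form $s\sqsubseteq t$ or $s=t$ for terms $s,t$; $\alpha\vee\beta$ and $\alpha\wedge\beta$ are $\Sigma$-formulas if $\alpha,\beta$ are; $(\exists x\sqsubseteq t)\alpha$, $(\forall x\sqsubseteq t)\alpha$ and $(\exists x)\alpha$ are $\Sigma$-formulas if $\alpha$ is. Two formulas $\phi,\phi'$ are equivalent in $\mathfrak{B}$ if $\mathfrak{B}\models\phi\leftrightarrow\phi'$, i.e. the equivalence holds under every assignment of bit strings to the free variables. *)

(* Defs.v *)
From mathcomp Require Import all_boot.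

Set Implicit Arguments.
Unset Strict Implicit.
Unset Printing Implicit Defensive.

Inductive term : Type :=
  | TVar (x : nat)
  | TEmp
  | TZero
  | TOne
  | TCat (s t : term).

Inductive formula : Type :=
  | FEq (s t : term)
  | FSub (s t : term)
  | FNeg (a : formula)
  | FAnd (a b : formula)
  | FOr (a b : formula)
  | FImp (a b : formula)
  | FEx (x : nat) (a : formula)
  | FAll (x : nat) (a : formula).

Fixpoint occurs (x : nat) (t : term) : bool :=
  match t with
  | TVar y => x == y
  | TEmp | TZero | TOne => false
  | TCat s1 s2 => occurs x s1 || occurs x s2
  end.

(* These abbreviations are only meant for [x] not occurring in [t]; the
   predicates below impose that condition wherever they are used. *)
Definition FBEx (x : nat) (t : term) (a : formula) : formula :=
  FEx x (FAnd (FSub (TVar x) t) a).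
Definition FBAll (x : nat) (t : term) (a : formula) : formula :=
  FAll x (FImp (FSub (TVar x) t) a).

Record structure : Type := Structure {
  universe :> Type;
  emp_of : universe;
  zero_of : universe;
  one_of : universe;
  cat_of : universe -> universe -> universe;
  sub_of : universe -> universe -> Prop
}.

Definition substring (u v : seq bool) : Prop :=
  exists x y : seq bool, x ++ u ++ y = v.

Definition frakB : structure :=
  {| universe := seq bool;
     emp_of := [::];
     zero_of := [:: false];
     one_of := [:: true];
     cat_of := @cat bool;
     sub_of := substring |}.

Fixpoint eval (M : structure) (rho : nat -> M) (t : term) : M :=
  match t with
  | TVar x => rho x
  | TEmp => emp_of M
  | TZero => zero_of M
  | TOne => one_of M
  | TCat s1 s2 => cat_of (eval rho s1) (eval rho s2)
  end.

Definition update (M : structure) (rho : nat -> M) (x : nat) (a : M)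
    : nat -> M :=
  fun y => if y == x then a else rho y.

Fixpoint sat (M : structure) (rho : nat -> M) (f : formula) : Prop :=
  match f with
  | FEq s t => eval rho s = eval rho t
  | FSub s t => sub_of (eval rho s) (eval rho t)
  | FNeg a => ~ sat rho a
  | FAnd a b => sat rho a /\ sat rho b
  | FOr a b => sat rho a \/ sat rho b
  | FImp a b => sat rho a -> sat rho b
  | FEx x a => exists u : M, sat (update rho x u) a
  | FAll x a => forall u : M, sat (update rho x u) a
  end.

Definition equivalent_in (M : structure) (f g : formula) : Prop :=
  forall rho : nat -> M, sat rho f <-> sat rho g.

Inductive is_Sigma : formula -> Prop :=
  | Sigma_eq s t : is_Sigma (FEq s t)
  | Sigma_sub s t : is_Sigma (FSub s t)
  | Sigma_neq s t : is_Sigma (FNeg (FEq s t))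
  | Sigma_nsub s t : is_Sigma (FNeg (FSub s t))
  | Sigma_or a b : is_Sigma a -> is_Sigma b -> is_Sigma (FOr a b)
  | Sigma_and a b : is_Sigma a -> is_Sigma b -> is_Sigma (FAnd a b)
  | Sigma_bex x t a : ~~ occurs x t -> is_Sigma a -> is_Sigma (FBEx x t a)
  | Sigma_ball x t a : ~~ occurs x t -> is_Sigma a -> is_Sigma (FBAll x t a)
  | Sigma_ex x a : is_Sigma a -> is_Sigma (FEx x a).

(* A (possibly empty) block of bounded quantifiers in front of one equation. *)
Inductive is_bounded_prenex_eq : formula -> Prop :=
  | Prenex_eq s t : is_bounded_prenex_eq (FEq s t)
  | Prenex_bex v t a : ~~ occurs v t ->
      is_bounded_prenex_eq a -> is_bounded_prenex_eq (FBEx v t a)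
  | Prenex_ball v t a : ~~ occurs v t ->
      is_bounded_prenex_eq a -> is_bounded_prenex_eq (FBAll v t a).

(* Main.v *)
Require Import Defs.
From mathcomp Require Import all_boot.
From Stdlib Require Import Classical.

(** Over bit strings, conjunctions, disjunctions and negated atoms can be
    absorbed into one equation at the price of a few bounded quantifiers, and
    the unbounded quantifiers can be merged into one outermost witness.

    A conjunction of equations is one equation: [a = c] and [b = d] together
    amount to [a 0 b a 1 b = c 0 d c 1 d], where the marker bit, [0] in one
    half and [1] in the other, forces [a] and [c] to end at the same place
    ([cat_marked_inj]).

    For a disjunction, pick [z] and [z'] with [z ++ z' = 0]: one of them is [0]
    and the other is empty.  A word commuting with the empty word is arbitrary,
    whereas a word commuting with [0] consists of [0]s only, and such a word is
    empty when it begins or ends a word that is delimited by [1]s.  Hence the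
    equation [x 1 s 1 = 1 t 1 y], with [x] and [y] commuting with [z], says
    [s = t] when [z = 0] and is always solvable when [z] is empty
    ([guarded_zeroP], [guarded_nil]).  Applied to [z] and to [z'], this expresses a disjunction
    of two equations ([or_eqP]).

    Bounded quantifiers always range over a nonempty set, since the empty word
    is a substring of every word, so they can be pulled out of conjunctions and
    disjunctions ([prenex_def_connective]).  The substring relation, its
    negation and inequality then have bounded definitions.

    An unbounded existential quantifier is handled by keeping a single leading
    witness [w] on which the rest depends monotonically with respect to the
    substring relation ([sigma_def]).  Two witnesses are merged by
    concatenation, and, because a word has finitely many substrings, the
    witnesses below a bounded universal quantifier are merged in the same way
    ([collection]).

    Variable capture is avoided by working with predicates on assignments
    rather than with formulas: a predicate definable at level [n] depends on
    the variables below [n] only, and the quantifier introduced at level [n]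
    binds the variable [n]. *)

Set Implicit Arguments.
Unset Strict Implicit.
Unset Printing Implicit Defensive.

Notation env := (nat -> frakB).

(** * Words and substrings *)

Lemma substring_refl u : substring u u.
Proof. by exists [::], [::]; rewrite cats0. Qed.

Lemma substring_nil u : substring [::] u.
Proof. by exists [::], u. Qed.

Lemma substring_catl u v w : substring u v -> substring u (v ++ w).
Proof. by move=> [x [y <-]]; exists x, (y ++ w); rewrite !catA. Qed.

Lemma substring_catr u v w : substring u v -> substring u (w ++ v).
Proof. by move=> [x [y <-]]; exists (w ++ x), y; rewrite !catA. Qed.

Lemma substring_trans u v w : substring u v -> substring v w -> substring u w.
Proof.
by move=> uv [x [y <-]]; apply: substring_catr; apply: substring_catl.
Qed.

Lemma substring_enum (v : seq bool) :
  exists L : seq (seq bool), forall u, substring u v -> u \in L.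
Proof.
exists [seq take j (drop i v) | i <- iota 0 (size v).+1,
                                j <- iota 0 (size v).+1].
move=> u [x [y <-]]; apply/allpairsP; exists (size x, size u).
rewrite [_.1]/= [_.2]/=.
rewrite drop_size_cat // take_size_cat // !mem_iota !size_cat !add0n !ltnS.
by rewrite leq_addr addnCA leq_addr.
Qed.

(** Only finitely many witnesses have to be merged, and [F] survives each
    enlargement of a witness. *)
Lemma collection (v : seq bool) (F : seq bool -> seq bool -> Prop) :
    (forall u w w', substring w w' -> F u w -> F u w') ->
    (forall u, substring u v -> exists w, F u w) ->
  exists w, forall u, substring u v -> F u w.
Proof.
move=> Fup Fex; have [L LP] := substring_enum v.
suff [w wP] : exists w, forall u, u \in L -> substring u v -> F u w.
  by exists w => u uv; apply: wP => //; apply: LP.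
elim: L {LP} => [|u0 L [w wP]]; first by exists [::].
have [w0 w0P] : exists w0, substring u0 v -> F u0 w0.
  have [/Fex [w0 Fw0]|Nu0] := classic (substring u0 v); first by exists w0.
  by exists [::].
exists (w ++ w0) => u; rewrite inE => /orP [/eqP->|uL] uv.
  by apply: (Fup _ w0) (w0P uv); apply: substring_catr (substring_refl _).
by apply: (Fup _ w) (wP u uL uv); apply: substring_catl (substring_refl _).
Qed.

(** The sides need not be cut at the same place a priori.  The total length is
    twice the length of either half, so the halves agree; if [a] were shorter
    than [c], then [c] would carry at the position [size a] the marker [0] by the
    first half and the marker [1] by the second. *)
Lemma cat_marked_inj (a b c d : seq bool) :
    (a ++ [:: false] ++ b) ++ (a ++ [:: true] ++ b) =
    (c ++ [:: false] ++ d) ++ (c ++ [:: true] ++ d) ->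
  a = c /\ b = d.
Proof.
move=> E; have sz : size (a ++ [:: false] ++ b) = size (c ++ [:: false] ++ d).
  apply: double_inj; move: (congr1 size E).
  by rewrite -!addnn !size_cat.
move/eqP: E; rewrite eqseq_cat //; case/andP=> /eqP E0 /eqP E1 {sz}.
elim: a c E0 E1 => [|i a IH] [|j c] /=.
- by move=> [->].
- by move=> [<- _] [].
- by move=> [-> _] [].
by move=> [-> /IH E] [/E [-> ->]].
Qed.

Lemma cat_eq1 (x y : seq bool) b :
  x ++ y = [:: b] -> (x = [::] /\ y = [:: b]) \/ (x = [:: b] /\ y = [::]).
Proof.
case: x => [|i x] /=; first by left.
by case: x => // -[->]; case: y => // _; right.
Qed.

Lemma commutes_with_zero (x : seq bool) :
  x ++ [:: false] = [:: false] ++ x -> x = nseq (size x) false.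
Proof. by elim: x => //= i x IH [-> /IH {1}->]. Qed.

(** The condition [z = 0 -> a = b] as a solvable system of equations, for [z]
    equal to [0] or empty. *)
Definition guarded (z a b : seq bool) : Prop :=
  let a1 := [:: true] ++ a ++ [:: true] in
  let b1 := [:: true] ++ b ++ [:: true] in
  exists x, substring x b1 /\ exists y, substring y a1 /\
    ((x ++ a1 = b1 ++ y /\ x ++ z = z ++ x) /\ y ++ z = z ++ y).

Lemma guarded_nil a b : guarded [::] a b.
Proof.
exists ([:: true] ++ b ++ [:: true]); split; first exact: substring_refl.
exists ([:: true] ++ a ++ [:: true]); split; first exact: substring_refl.
by rewrite !cats0.
Qed.

(** Both [x] and [y] are words over [0], so the delimiter [1] at the left end of
    the equation rules out a nonempty [x], and the one at the right end rules
    out a nonempty [y]. *)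
Lemma guarded_zeroP a b : guarded [:: false] a b <-> a = b.
Proof.
split=> [[x [_ [y [_ [[E /commutes_with_zero xE] /commutes_with_zero yE]]]]]|->].
  have x0 : x = [::] by case: x E xE => [|[] x].
  move: E; rewrite x0 /= => -[]; case/lastP: y yE => [|y c yE].
    by rewrite cats0 => _ /(congr1 rev); rewrite !rev_cat => -[/(can_inj revK)].
  have -> : c = false.
    by move: (mem_rcons y c c); rewrite yE inE eqxx mem_nseq => /andP [_ /eqP].
  by rewrite -!cats1 => /(congr1 rev); rewrite !catA !rev_cat.
by exists [::]; split; [apply: substring_nil|exists [::]; split;
  [apply: substring_nil|rewrite /= cats0]].
Qed.

Lemma or_eqP (a b c d : seq bool) :
  a = b \/ c = d <->
  exists z, substring z [:: false] /\ exists z', substring z' [:: false] /\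
    ((z ++ z' = [:: false] /\ guarded z a b) /\ guarded z' c d).
Proof.
split=> [|[z [_ [z' [_ [[/cat_eq1 [[-> ->]|[-> ->]]]]]]]]].
- case=> [->|->].
    exists [:: false]; split; first exact: substring_refl.
    exists [::]; split; first exact: substring_nil.
    by split; [split=> //; apply/guarded_zeroP|apply: guarded_nil].
  exists [::]; split; first exact: substring_nil.
  exists [:: false]; split; first exact: substring_refl.
  by split; [split=> //; apply: guarded_nil|apply/guarded_zeroP].
- by move=> _ /guarded_zeroP; right.
by move=> /guarded_zeroP; left.
Qed.

(** One orientation of a mismatch: either a first position where [a] carries [0]
    and [b] carries [1], or [b] ending before [a] does.  Exchanging [a] and [b]
    gives the other cases of inequality, and the bounds on [x], [y] and [y'] are
    automatic, as these words are cut out of [a] and [b]. *)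
Definition splits_below (a b : seq bool) : Prop :=
  exists x, substring x a /\ exists y, substring y a /\
  exists y', substring y' b /\
    ((a = x ++ [:: false] ++ y /\ b = x ++ [:: true] ++ y') \/
     (a = b ++ [:: false] ++ y \/ a = b ++ [:: true] ++ y)).

Lemma splits_below_cons i a b :
  splits_below a b -> splits_below (i :: a) (i :: b).
Proof.
have up (u v : seq bool) : substring u v -> substring u (i :: v).
  exact: (@substring_catr _ _ [:: i]).
move=> [x [[p [q xa]] [y [ya [y' [y'b H]]]]]].
case: H => [[aE bE]|H].
  exists (i :: x); split; first by exists [::], ([:: false] ++ y); rewrite aE.
  exists y; split; first exact: up.
  exists y'; split; first exact: up.
  by left; rewrite aE bE.
exists [::]; split; first exact: substring_nil.
exists y; split; first exact: up.
exists y'; split; first exact: up.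
by right; case: H => ->; [left|right].
Qed.

Lemma splits_below_nil i a : splits_below (i :: a) [::].
Proof.
exists [::]; split; first exact: substring_nil.
exists a; split; first exact: (@substring_catr _ _ [:: i] (substring_refl a)).
exists [::]; split; first exact: substring_nil.
by right; case: i; [right|left].
Qed.

Lemma splits_below_bits a b : splits_below (false :: a) (true :: b).
Proof.
exists [::]; split; first exact: substring_nil.
exists a; split; first exact: (@substring_catr _ _ [:: false] (substring_refl a)).
exists b; split; first exact: (@substring_catr _ _ [:: true] (substring_refl b)).
by left.
Qed.

Lemma splits_below_neq a b : splits_below a b -> a <> b.
Proof.
move=> [x [_ [y [_ [y' [_ [[-> ->]|H]]]]]]].
  by move/eqP; rewrite eqseq_cat // eqxx.
by move=> E; case: H => /(congr1 size); rewrite E size_cat /= => /eqP;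
  rewrite -[X in X == _]addn0 eqn_add2l.
Qed.

Lemma neqP (a b : seq bool) : a <> b <-> splits_below a b \/ splits_below b a.
Proof.
split=> [|[/splits_below_neq //|/splits_below_neq ba ab]]; last exact: ba.
elim: a b => [|i a IH] [|j b] // ab.
- by right; apply: splits_below_nil.
- by left; apply: splits_below_nil.
case: (eqVneq i j) ab => [-> ab|ij _].
  have /IH [H|H] : a <> b by move=> E; rewrite E in ab.
    by left; apply: splits_below_cons.
  by right; apply: splits_below_cons.
case: i j ij => [] [] // _; last by left; apply: splits_below_bits.
by right; apply: splits_below_bits.
Qed.

(** * Renaming and dependence on variables *)

Fixpoint tbound (t : term) : nat :=
  match t with
  | TVar x => x.+1
  | TEmp | TZero | TOne => 0
  | TCat s1 s2 => maxn (tbound s1) (tbound s2)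
  end.

Fixpoint trename (f : nat -> nat) (t : term) : term :=
  match t with
  | TVar x => TVar (f x)
  | TCat s1 s2 => TCat (trename f s1) (trename f s2)
  | _ => t
  end.

Definition agree (n : nat) (rho rho' : env) : Prop :=
  forall i, i < n -> rho i = rho' i.

Lemma update_same (rho : env) n u : update rho n u n = u.
Proof. by rewrite /update eqxx. Qed.

Lemma agree_update n (rho : env) u : agree n (update rho n u) rho.
Proof. by move=> i ni; rewrite /update ltn_eqF. Qed.

Lemma update_lt n (rho : env) u i : i < n -> update rho n u i = rho i.
Proof. exact: agree_update. Qed.

Lemma agree_update2 n (rho rho' : env) u :
  agree n rho rho' -> agree n.+1 (update rho n u) (update rho' n u).
Proof.
move=> H i; rewrite /update ltnS leq_eqVlt; case: eqP => //= _ /H //.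
Qed.

Lemma agree_updateC n (rho : env) m x u w :
  x != n -> agree m (update (update rho x u) n w) (update (update rho n w) x u).
Proof.
by move=> xn i _; rewrite /update; case: eqP => [->|//]; rewrite eq_sym (negPf xn).
Qed.

Lemma eval_agree n t (rho rho' : env) :
  tbound t <= n -> agree n rho rho' -> eval rho t = eval rho' t.
Proof.
move=> tn H; elim: t tn => [x /H|||| s IHs t IHt] //=.
by rewrite geq_max => /andP [/IHs-> /IHt->].
Qed.

Lemma eval_update n t (rho : env) u :
  tbound t <= n -> eval (update rho n u) t = eval rho t.
Proof. by move=> tn; apply: eval_agree tn _; apply: agree_update. Qed.

Lemma eval_update_notin x t (rho : env) u :
  ~~ occurs x t -> eval (update rho x u) t = eval rho t.
Proof.
elim: t => //= [y|s IHs t IHt]; first by rewrite /update eq_sym => /negPf->.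
by rewrite negb_or => /andP [/IHs-> /IHt->].
Qed.

Lemma tbound_notin n t : tbound t <= n -> ~~ occurs n t.
Proof.
elim: t => //= [x|s IHs t IHt]; first by move=> xn; rewrite gtn_eqF.
by rewrite geq_max negb_or => /andP [/IHs-> /IHt->].
Qed.

Lemma eval_trename f t (rho : env) :
  eval rho (trename f t) = eval (fun i => rho (f i)) t.
Proof. by elim: t => //= s -> t ->. Qed.

Lemma tbound_trename f n m t :
  (forall i, i < n -> f i < m) -> tbound t <= n -> tbound (trename f t) <= m.
Proof.
move=> fnm; elim: t => //= s IHs t IHt.
by rewrite !geq_max => /andP [/IHs-> /IHt->].
Qed.

(** * Predicates defined by a bounded prefix and one equation *)

Definition bounded (q : bool) (v : seq bool) (F : seq bool -> Prop) : Prop :=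
  if q then exists u, substring u v /\ F u else forall u, substring u v -> F u.

Lemma bounded_ext q v F G :
  (forall u, F u <-> G u) -> bounded q v F <-> bounded q v G.
Proof.
move=> FG; case: q => /=; last by split=> H u /H /FG.
by split=> -[u [uv /FG]]; exists u.
Qed.

(** The equivalences carried by the constructors make the class closed under
    equivalence of predicates without an appeal to extensionality. *)
Inductive prenex_def : nat -> (env -> Prop) -> Prop :=
  | PrenexDefEq n s t P : tbound s <= n -> tbound t <= n ->
      (forall rho : env, P rho <-> eval rho s = eval rho t) -> prenex_def n P
  | PrenexDefQuant q n t P Q : tbound t <= n -> prenex_def n.+1 Q ->
      (forall rho : env, P rho <->
         bounded q (eval rho t) (fun u => Q (update rho n u))) ->
      prenex_def n P.

Lemma prenex_def_ext n P Q :
  prenex_def n P -> (forall rho, Q rho <-> P rho) -> prenex_def n Q.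
Proof.
case=> {n P} [n s t P sn tn PE|q n t P P1 tn P1n PE] QP.
  by apply: (PrenexDefEq sn tn) => rho; rewrite QP.
by apply: (PrenexDefQuant (q := q) tn P1n) => rho; rewrite QP.
Qed.

Lemma prenex_def_agree n P rho rho' :
  prenex_def n P -> agree n rho rho' -> P rho <-> P rho'.
Proof.
move=> Pn; elim: Pn rho rho' => {n P} [n s t P sn tn PE|q n t P Q tn _ IH PE]
  rho rho' A; rewrite !PE.
  by rewrite (eval_agree sn A) (eval_agree tn A).
rewrite (eval_agree tn A); apply: bounded_ext => u.
by apply: IH; apply: agree_update2.
Qed.

Lemma prenex_def_update n P rho u :
  prenex_def n P -> P (update rho n u) <-> P rho.
Proof. by move=> Pn; apply: prenex_def_agree Pn _; apply: agree_update. Qed.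

Lemma prenex_def_rename n m f P : prenex_def n P ->
  (forall i, i < n -> f i < m) -> prenex_def m (fun rho : env => P (fun i => rho (f i))).
Proof.
move=> Pn; elim: Pn m f => {n P} [n s t P sn tn PE|q n t P Q tn Qn IH PE] m f fnm.
  apply: (PrenexDefEq (tbound_trename fnm sn) (tbound_trename fnm tn)) => rho.
  by rewrite PE !eval_trename.
have f'nm i : i < n.+1 -> (if i == n then m else f i) < m.+1.
  rewrite ltnS leq_eqVlt; case: eqP => //= _ /fnm fm; exact: ltnW.
apply: (PrenexDefQuant (q := q) (tbound_trename fnm tn) (IH _ _ f'nm)) => rho.
rewrite PE eval_trename; apply: bounded_ext => u.
apply: (prenex_def_agree Qn) => i; rewrite /update ltnS leq_eqVlt.
by case: eqP => /= [_ _|_ /fnm fm]; rewrite ?eqxx // ltn_eqF.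
Qed.

Lemma prenex_def_widen n m P : n <= m -> prenex_def n P -> prenex_def m P.
Proof.
move=> nm Pn; apply: (prenex_def_ext (prenex_def_rename (f := id) Pn _)) => //.
by move=> i /leq_trans; apply.
Qed.

(** Quantification over a variable [x] that is already in use at level [n]: the
    bound variable is renamed to [n]. *)
Lemma prenex_def_quant_var q n t x P : x < n -> tbound t <= n -> prenex_def n P ->
  prenex_def n (fun rho : env => bounded q (eval rho t) (fun u => P (update rho x u))).
Proof.
move=> xn tn Pn.
have fn i : i < n -> (if i == x then n else i) < n.+1.
  by case: eqP => // _ /leqW.
apply: (PrenexDefQuant (q := q) tn (prenex_def_rename Pn fn)) => rho.
apply: bounded_ext => u; apply: (prenex_def_agree Pn) => i ni.
by rewrite /update; case: (i =P x) => _; rewrite ?eqxx // ltn_eqF.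
Qed.

Lemma prenex_def_formula n P : prenex_def n P ->
  exists psi, is_bounded_prenex_eq psi /\ forall rho : env, P rho <-> sat (M := frakB) rho psi.
Proof.
elim=> {n P} [n s t P sn tn PE|q n t P Q tn Qn [psi [psiB psiE]] PE].
  by exists (FEq s t); split; first by constructor.
have nt := tbound_notin tn.
exists ((if q then FBEx else FBAll) n t psi); split.
  by case: q {PE}; constructor.
move=> rho; rewrite PE; case: q {PE} => /=.
  by split=> -[u [H /psiE K]]; exists u; move: H; rewrite update_same eval_update.
split=> [H u|H u uv]; first by rewrite update_same eval_update // => /H /psiE.
by apply/psiE/H; rewrite update_same eval_update.
Qed.

(** * Connectives *)

(** A connective that commutes with quantification over nonempty sets is
    reduced to its action on two equations by moving the quantifiers of either
    side in front of it. *)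
Section Connective.

Variable op : Prop -> Prop -> Prop.
Hypothesis opC : forall A B, op A B <-> op B A.
Hypothesis op_iff : forall A A' B, (A <-> A') -> op A B <-> op A' B.
Hypothesis op_bounded : forall q v F B,
  op (bounded q v F) B <-> bounded q v (fun u => op (F u) B).
Hypothesis op_eq : forall n s t s' t',
  tbound s <= n -> tbound t <= n -> tbound s' <= n -> tbound t' <= n ->
  prenex_def n (fun rho : env =>
    op (eval rho s = eval rho t) (eval rho s' = eval rho t')).

Lemma op_quant q n t P P1 Q : tbound t <= n ->
    (forall rho : env, P rho <->
       bounded q (eval rho t) (fun u => P1 (update rho n u))) ->
    prenex_def n Q -> prenex_def n.+1 (fun rho => op (P1 rho) (Q rho)) ->
  prenex_def n (fun rho => op (P rho) (Q rho)).
Proof.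
move=> tn PE Qn opn; apply: (PrenexDefQuant (q := q) tn opn) => rho.
rewrite (op_iff _ (PE rho)) op_bounded; apply: bounded_ext => u.
by rewrite opC [X in _ <-> X]opC; apply: op_iff; rewrite (prenex_def_update _ _ Qn).
Qed.

Lemma prenex_def_connective n P Q :
  prenex_def n P -> prenex_def n Q -> prenex_def n (fun rho => op (P rho) (Q rho)).
Proof.
move=> Pn; elim: Pn Q => {n P} [n s t P sn tn PE|q n t P P1 tn _ IH PE] Q Qn;
  last exact: op_quant tn PE Qn (IH _ (prenex_def_widen (leqnSn n) Qn)).
elim: Qn s t P sn tn PE => {n Q} [n s' t' Q sn' tn' QE|q n t' Q Q1 tn' _ IH QE]
  s t P sn tn PE.
  apply: (prenex_def_ext (op_eq sn tn sn' tn')) => rho.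
  by rewrite (op_iff _ (PE rho)) opC (op_iff _ (QE rho)) opC.
apply: (prenex_def_ext (P := fun rho => op (Q rho) (P rho))); last by move=> rho.
apply: (op_quant tn' QE); first exact: (PrenexDefEq sn tn).
apply: (prenex_def_ext (P := fun rho => op (P rho) (Q1 rho))); last by move=> rho.
exact: (IH s t P (leqW sn) (leqW tn)).
Qed.

End Connective.

Lemma prenex_def_and n P Q :
  prenex_def n P -> prenex_def n Q -> prenex_def n (fun rho => P rho /\ Q rho).
Proof.
apply: prenex_def_connective => [A B|A A' B AA'|q v F B|{}n s t s' t' sn tn sn' tn'].
- by split=> -[].
- by rewrite AA'.
- case: q => /=; first by split=> [[[u [uv Fu]] b]|[u [uv [Fu b]]]];
    [exists u|split=> //; exists u].
  split=> [[H b] u /H //|H].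
  by split=> [u /H []|] //; case: (H _ (substring_nil v)).
pose cat3 a c b := TCat a (TCat c b).
pose mark a b := TCat (cat3 a TZero b) (cat3 a TOne b).
apply: (@PrenexDefEq _ (mark s s') (mark t t')) => [||rho] /=.
- by rewrite !geq_max sn sn'.
- by rewrite !geq_max tn tn'.
by split=> [[-> ->]|/cat_marked_inj].
Qed.

Lemma prenex_def_ex n t P : tbound t <= n -> prenex_def n.+1 P ->
  prenex_def n (fun rho : env =>
    exists u, substring u (eval rho t) /\ P (update rho n u)).
Proof. by move=> tn Pn; apply: (PrenexDefQuant (q := true) tn Pn). Qed.

Ltac below := by rewrite /= ?geq_max; repeat (apply/andP; split); auto using leqW.

Lemma prenex_def_guarded n z s t :
  tbound z <= n -> tbound s <= n -> tbound t <= n ->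
  prenex_def n (fun rho : env => guarded (eval rho z) (eval rho s) (eval rho t)).
Proof.
move=> zn sn tn; pose delim a := TCat TOne (TCat a TOne).
pose x := TVar n; pose y := TVar n.+1.
have comm a : tbound a <= n.+2 -> prenex_def n.+2 (fun rho : env =>
    eval rho (TCat a z) = eval rho (TCat z a)).
  by move=> an; apply: (@PrenexDefEq _ (TCat a z) (TCat z a)) => //; below.
have base : prenex_def n.+2 (fun rho : env =>
    eval rho (TCat x (delim s)) = eval rho (TCat (delim t) y)).
  by apply: (@PrenexDefEq _ (TCat x (delim s)) (TCat (delim t) y)) => //; below.
have xn : tbound x <= n.+2 by below.
have yn : tbound y <= n.+2 by below.
have := prenex_def_and (prenex_def_and base (comm x xn)) (comm y yn).
have dsn : tbound (delim s) <= n by below.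
have dtn : tbound (delim t) <= n by below.
move=> /(prenex_def_ex (leqW dsn)) /(prenex_def_ex dtn) H.
apply: (prenex_def_ext H) => rho.
apply: (@bounded_ext true) => x0; rewrite (eval_update _ _ dsn).
apply: (@bounded_ext true) => y0; rewrite /x /y /delim /=.
by rewrite !(update_same, update_lt, eval_update) // ?leqW.
Qed.

Lemma prenex_def_or n P Q :
  prenex_def n P -> prenex_def n Q -> prenex_def n (fun rho => P rho \/ Q rho).
Proof.
apply: prenex_def_connective => [A B|A A' B AA'|q v F B|{}n s t s' t' sn tn sn' tn'].
- by split=> -[]; [right|left|right|left].
- by rewrite AA'.
- case: q => /=.
    split=> [[[u [uv Fu]]|b]|[u [uv [Fu|b]]]].
    + by exists u; split=> //; left.
    + by exists [::]; split; [apply: substring_nil|right].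
    + by left; exists u.
    + by right.
  split=> [[H|b] u uv|H]; [by left; apply: H|by right|].
  (* The disjunct [B] has to be decided before the quantifier is entered. *)
  have [b|nb] := classic B; [by right|left=> u uv].
  by case: (H u uv).
pose z := TVar n; pose z' := TVar n.+1.
have base : prenex_def n.+2 (fun rho : env =>
    eval rho (TCat z z') = eval rho TZero).
  by apply: (@PrenexDefEq _ (TCat z z') TZero) => //; below.
have G a b c : tbound a <= n.+2 -> tbound b <= n -> tbound c <= n ->
    prenex_def n.+2 (fun rho : env => guarded (eval rho a) (eval rho b) (eval rho c)).
  by move=> an bn cn; apply: prenex_def_guarded => //; below.
have zn : tbound z <= n.+2 by below.
have zn' : tbound z' <= n.+2 by below.
have := prenex_def_and (prenex_def_and base (G _ _ _ zn sn tn)) (G _ _ _ zn' sn' tn').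
have z0 m : tbound TZero <= m by [].
move=> /(prenex_def_ex (z0 _)) /(prenex_def_ex (z0 _)) H.
apply: (prenex_def_ext H) => rho; rewrite or_eqP.
apply: (@bounded_ext true) => x0; apply: (@bounded_ext true) => y0 /=.
by rewrite !(update_same, update_lt, eval_update) // ?leqW.
Qed.

(** * Literals *)

Lemma prenex_def_eq n s t : tbound s <= n -> tbound t <= n ->
  prenex_def n (fun rho : env => eval rho s = eval rho t).
Proof. by move=> sn tn; apply: (PrenexDefEq sn tn). Qed.

Lemma prenex_def_splits_below n s t : tbound s <= n -> tbound t <= n ->
  prenex_def n (fun rho : env => splits_below (eval rho s) (eval rho t)).
Proof.
move=> sn tn; pose x := TVar n; pose y := TVar n.+1; pose y' := TVar n.+2.
have E a b c d : tbound a <= n.+3 -> tbound b <= n.+3 -> tbound d <= n.+3 ->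
    tbound c = 0 -> prenex_def n.+3 (fun rho : env =>
      eval rho a = eval rho (TCat b (TCat c d))).
  move=> an bn dn c0; apply: prenex_def_eq => //=.
  by rewrite c0 !geq_max bn dn.
have sn1 : tbound s <= n.+1 by below.
have sn3 : tbound s <= n.+3 by below.
have tn2 : tbound t <= n.+2 by below.
have tn3 : tbound t <= n.+3 by below.
have xn : tbound x <= n.+3 by below.
have yn : tbound y <= n.+3 by below.
have yn' : tbound y' <= n.+3 by below.
have M := prenex_def_and (E s x TZero y sn3 xn yn erefl)
                         (E t x TOne y' tn3 xn yn' erefl).
have X := prenex_def_or (E s t TZero y sn3 tn3 yn erefl)
                        (E s t TOne y sn3 tn3 yn erefl).
move: (prenex_def_or M X).
move=> /(prenex_def_ex tn2) /(prenex_def_ex sn1) /(prenex_def_ex sn) H.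
apply: (prenex_def_ext H) => rho.
apply: (@bounded_ext true) => x0; rewrite eval_update //.
apply: (@bounded_ext true) => y0; rewrite !eval_update ?leqW //.
apply: (@bounded_ext true) => y1 /=.
by rewrite !(update_same, update_lt, eval_update) // ?leqW // ltnW.
Qed.

Lemma prenex_def_neq n s t : tbound s <= n -> tbound t <= n ->
  prenex_def n (fun rho : env => eval rho s <> eval rho t).
Proof.
move=> sn tn; have := prenex_def_or (prenex_def_splits_below sn tn)
                                   (prenex_def_splits_below tn sn).
by move=> H; apply: (prenex_def_ext H) => rho; apply: neqP.
Qed.

Lemma prenex_def_sub n s t : tbound s <= n -> tbound t <= n ->
  prenex_def n (fun rho : env => substring (eval rho s) (eval rho t)).
Proof.
move=> sn tn; pose x := TVar n; pose y := TVar n.+1.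
have base : prenex_def n.+2 (fun rho : env =>
    eval rho (TCat x (TCat s y)) = eval rho t).
  by apply: prenex_def_eq; below.
have tn1 : tbound t <= n.+1 by below.
move: base => /(prenex_def_ex tn1) /(prenex_def_ex tn) H.
apply: (prenex_def_ext H) => rho.
split=> [[x0 [y0 E]]|[x0 [_ [y0 [_]]]] /=].
  exists x0; split; first by exists [::], (eval rho s ++ y0).
  exists y0; rewrite /= !(update_same, update_lt, eval_update) // ?leqW //.
  by split=> //; exists (x0 ++ eval rho s), [::]; rewrite cats0 -catA.
rewrite !(update_same, update_lt, eval_update) // ?leqW // => E.
by exists x0, y0.
Qed.

(** The negated existential over contexts turns into a universal quantifier over
    the substrings of [t], each of which has to differ from [s]. *)
Lemma prenex_def_nsub n s t : tbound s <= n -> tbound t <= n ->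
  prenex_def n (fun rho : env => ~ substring (eval rho s) (eval rho t)).
Proof.
move=> sn tn; have xn : tbound (TVar n) <= n.+1 by [].
apply: (PrenexDefQuant (q := false) tn (prenex_def_neq xn (leqW sn))) => rho /=.
split=> [H u ut|H /H]; last by rewrite update_same eval_update.
by rewrite update_same eval_update // => E; apply: H; rewrite -E.
Qed.

(** * Predicates with one leading witness *)

Definition upward (n : nat) (R : env -> Prop) : Prop :=
  forall (rho : env) w w', substring w w' -> R (update rho n w) -> R (update rho n w').

(** Monotonicity in the witness makes it possible to share one witness between
    several conditions, each of which needs one of its own. *)
Definition sigma_def (n : nat) (P : env -> Prop) : Prop :=
  exists R, [/\ prenex_def n.+1 R, upward n R &
    forall rho : env, P rho <-> exists w, R (update rho n w)].

Lemma sigma_def_ext n P Q :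
  sigma_def n P -> (forall rho, Q rho <-> P rho) -> sigma_def n Q.
Proof. by move=> [R [Rn Rup PE]] QP; exists R; split=> // rho; rewrite QP. Qed.

Lemma sigma_def_prenex n P : prenex_def n P -> sigma_def n P.
Proof.
move=> Pn; exists P; split=> [|rho w w' _|rho]; first exact: prenex_def_widen Pn.
  by rewrite !(prenex_def_update _ _ Pn).
split=> [H|[w]]; last by rewrite (prenex_def_update _ _ Pn).
by exists [::]; rewrite (prenex_def_update _ _ Pn).
Qed.

Lemma sigma_def_or n P Q :
  sigma_def n P -> sigma_def n Q -> sigma_def n (fun rho => P rho \/ Q rho).
Proof.
move=> [R [Rn Rup PE]] [S [Sn Sup QE]].
exists (fun rho => R rho \/ S rho); split=> [|rho w w' ww'|rho].
- exact: prenex_def_or.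
- by case=> [/(Rup _ _ _ ww')|/(Sup _ _ _ ww')]; [left|right].
rewrite PE QE; split=> [[[w H]|[w H]]|[w [H|H]]].
- by exists w; left.
- by exists w; right.
- by left; exists w.
by right; exists w.
Qed.

Lemma sigma_def_and n P Q :
  sigma_def n P -> sigma_def n Q -> sigma_def n (fun rho => P rho /\ Q rho).
Proof.
move=> [R [Rn Rup PE]] [S [Sn Sup QE]].
exists (fun rho => R rho /\ S rho); split=> [|rho w w' ww' [H K]|rho].
- exact: prenex_def_and.
- by split; [apply: Rup ww' H|apply: Sup ww' K].
rewrite PE QE; split=> [[[w H] [w' K]]|[w [H K]]]; last by split; exists w.
exists (w ++ w'); split.
  exact: Rup (substring_catl _ (substring_refl w)) H.
exact: Sup (substring_catr _ (substring_refl w')) K.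
Qed.

Section QuantifierOverVariable.

Variables (n x : nat) (R : env -> Prop).
Hypotheses (xn : x < n) (Rn : prenex_def n.+1 R) (Rup : upward n R).

Lemma swap_update (rho : env) u w :
  R (update (update rho x u) n w) <-> R (update (update rho n w) x u).
Proof. by apply: prenex_def_agree Rn _; apply: agree_updateC; rewrite ltn_eqF. Qed.

Lemma upward_swap (rho : env) u w w' : substring w w' ->
  R (update (update rho n w) x u) -> R (update (update rho n w') x u).
Proof. by move=> ww'; rewrite -!swap_update; apply: Rup. Qed.

End QuantifierOverVariable.

(** The witness is also taken as a bound for the quantified variable. *)
Lemma sigma_def_ex n x P : x < n -> sigma_def n P ->
  sigma_def n (fun rho : env => exists u, P (update rho x u)).
Proof.
move=> xn [R [Rn Rup PE]].
have wn : tbound (TVar n) <= n.+1 by [].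
have := prenex_def_quant_var true (leqW xn) wn Rn => /= R'n.
eexists; split; first exact: R'n.
  move=> rho w w' ww'; rewrite !update_same => -[u [uw H]].
  by exists u; split; [apply: substring_trans ww'|apply: upward_swap H].
move=> rho; split=> [[u /PE [w H]]|[w [u [_ H]]]]; last first.
  by exists u; apply/PE; exists w; apply/(swap_update xn Rn).
exists (u ++ w), u; rewrite update_same; split.
  exact: substring_catl (substring_refl u).
apply/(swap_update xn Rn).
exact: Rup (substring_catr _ (substring_refl w)) H.
Qed.

(** By [collection], one witness serves all the substrings over which the
    universal quantifier ranges, so it can be chosen before them. *)
Lemma sigma_def_ball n x t P : x < n -> tbound t <= n -> sigma_def n P ->
  sigma_def n (fun rho : env =>
    forall u, substring u (eval rho t) -> P (update rho x u)).
Proof.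
move=> xn tn [R [Rn Rup PE]].
have := prenex_def_quant_var false (leqW xn) (leqW tn) Rn => /= R'n.
eexists; split; first exact: R'n.
  by move=> rho w w' ww' H u; rewrite eval_update // => ut;
    apply: (upward_swap xn Rn Rup ww'); apply: H; rewrite eval_update.
move=> rho; split=> [H|[w H] u ut]; last first.
  by apply/PE; exists w; apply/(swap_update xn Rn)/H; rewrite eval_update.
have [] := @collection (eval rho t) (fun u w => R (update (update rho x u) n w)).
- by move=> u w w'; apply: Rup.
- by move=> u /H /PE.
by move=> w wP; exists w => u; rewrite eval_update // => /wP /(swap_update xn Rn).
Qed.

(** The level is only required to be large, because the variables bound in the
    formula have to stay below it as well. *)
Lemma is_Sigma_sigma_def phi : is_Sigma phi ->
  exists N, forall n, N <= n -> sigma_def n (fun rho => sat (M := frakB) rho phi).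
Proof.
have lit (Q : seq bool -> seq bool -> Prop) s t :
    (forall n, tbound s <= n -> tbound t <= n ->
       prenex_def n (fun rho : env => Q (eval rho s) (eval rho t))) ->
    exists N, forall n, N <= n ->
      sigma_def n (fun rho : env => Q (eval rho s) (eval rho t)).
  move=> H; exists (maxn (tbound s) (tbound t)) => n; rewrite geq_max.
  by case/andP=> sn tn; apply/sigma_def_prenex/H.
elim=> {phi} [s t|s t|s t|s t|a b _ [N Na] _ [N' Nb]|a b _ [N Na] _ [N' Nb]
             |x t a xt _ [N Na]|x t a xt _ [N Na]|x a _ [N Na]].
- exact: (lit eq s t (fun n => @prenex_def_eq n s t)).
- exact: (lit substring s t (fun n => @prenex_def_sub n s t)).
- exact: (lit (fun u v => u <> v) s t (fun n => @prenex_def_neq n s t)).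
- exact: (lit (fun u v => ~ substring u v) s t (fun n => @prenex_def_nsub n s t)).
- exists (maxn N N') => n; rewrite geq_max => /andP [/Na an /Nb bn].
  exact: sigma_def_or.
- exists (maxn N N') => n; rewrite geq_max => /andP [/Na an /Nb bn].
  exact: sigma_def_and.
- exists (maxn N (maxn (tbound (TVar x)) (tbound t))) => n.
  rewrite !geq_max => /and3P [/Na an xn tn].
  have xt_n := sigma_def_prenex (@prenex_def_sub n (TVar x) t xn tn).
  exact: sigma_def_ex xn (sigma_def_and xt_n an).
- exists (maxn N (maxn x.+1 (tbound t))) => n.
  rewrite !geq_max => /and3P [/Na an xn tn].
  apply: (sigma_def_ext (sigma_def_ball xn tn an)) => rho /=.
  by split=> H u; move/(_ u): H; rewrite update_same eval_update_notin.
exists (maxn N x.+1) => n; rewrite geq_max => /andP [/Na an xn].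
exact: sigma_def_ex xn an.
Qed.

Theorem theorem12 (phi : formula) (hphi : is_Sigma phi) :
  exists phi' : formula,
    (is_bounded_prenex_eq phi' \/
     exists (v : nat) (psi : formula),
       is_bounded_prenex_eq psi /\ phi' = FEx v psi) /\
    equivalent_in frakB phi phi'.
Proof.
have [N /(_ N (leqnn N)) [R [RN _ phiE]]] := is_Sigma_sigma_def hphi.
have [psi [psiB psiE]] := prenex_def_formula RN.
exists (FEx N psi); split; first by right; exists N, psi.
by move=> rho; rewrite phiE /=; split=> -[w /psiE]; exists w.
Qed.
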